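(* Let $b=-\frac{7c_1}{64h^3}\,\mathsf E\big((\partial_x\beta)^3\big)$. If the statistics of the ensemble $(\Omega,\mathcal M,\mathsf P)$ are reversible in $x$, then $b=0$.
   Context: $g,h>0$ are constants and $c_1=\frac{h^3}{3}\sqrt{\frac{g}{4h}}$. $(\Omega,\mathcal M,\mathsf P)$ is a probability space with a group $\{\tau_y\}_{y\in\mathbb R}$ of $\mathsf P$-preserving ergodic translations, and $\beta(x;\omega)=G(\tau_x\omega)$ is a zero-mean stationary process on it whose realizations are almost surely bounded in $C^1(\mathbb R)$; $\mathsf E$ denotes expectation, and $\mathsf E((\partial_x\beta)^3)$ is the expectation of $(\partial_x\beta(x))^3$ at any point $x$ (independent of $x$ by stationarity). The statistics are called reversible in $x$ if the inversion $x\to-x$ preserves the probability measure $\mathsf P$, i.e. the process $x\mapsto\beta(-x)$ has the same law as $x\mapsto\beta(x)$. *)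

(* Defs.v *)
From HB Require Import structures.
From mathcomp Require Import all_boot all_order all_algebra.
From mathcomp Require Import all_classical all_reals all_analysis.

Set Implicit Arguments.
Unset Strict Implicit.
Unset Printing Implicit Defensive.

Import Order.TTheory GRing.Theory Num.Theory.
Import numFieldNormedType.Exports.
Local Open Scope classical_set_scope.
Local Open Scope ring_scope.

(* Joint measurability of (y, w) |-> tau y w is not required, so invariance in
   [translation_ergodic] is taken modulo P-null sets, as is usual in ergodic
   theory. *)
Record ergodic_translations (R : realType) (d : measure_display)
    (T : measurableType d) (P : probability T R) (tau : R -> T -> T) : Prop :=
  ErgodicTranslations {
    translation_measurable : forall y, measurable_fun setT (tau y) ;
    translation0 : forall w, tau 0 w = w ;
    translationD : forall x y w, tau (x + y) w = tau x (tau y w) ;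
    translation_preserving :
      forall y (A : set T), measurable A -> P (tau y @^-1` A) = P A ;
    translation_ergodic : forall A : set T, measurable A ->
      (forall y, P (tau y @^-1` A `+` A) = 0%E) -> P A = 0%E \/ P A = 1%E
  }.

Definition bounded_C1 (R : realType) (f : R -> R) : Prop :=
  [/\ forall x, derivable f x 1,
      continuous (derive1 f) &
      exists M : R, forall x, `|f x| <= M /\ `|derive1 f x| <= M].

(* The product sigma-algebra on the path space R -> R. *)
Definition path_events (R : realType) : set (set (R -> R)) :=
  <<s \bigcup_(x in [set: R])
        preimage_set_system setT (fun f : R -> R => f x) measurable >>.

Definition same_law (R : realType) (d : measure_display)
    (T : measurableType d) (P : probability T R) (X Y : R -> T -> R) : Prop :=
  forall B : set (R -> R), path_events B ->
    P [set w | B (X ^~ w)] = P [set w | B (Y ^~ w)].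

Definition reversible (R : realType) (d : measure_display)
    (T : measurableType d) (P : probability T R) (beta : R -> T -> R) : Prop :=
  same_law P (fun x => beta (- x)) beta.

Definition path_derivative (R : realType) (T : Type) (beta : R -> T -> R)
    (x : R) (w : T) : R := derive1 (beta ^~ w) x.

Definition c1 (R : realType) (g h : R) : R :=
  h ^+ 3 / 3 * Num.sqrt (g / (4 * h)).

(* Valued in \bar R like the library's expectation, so that [b_coef = 0]
   includes the finiteness of E((d_x beta)^3); x is the evaluation point. *)
Definition b_coef (R : realType) (d : measure_display)
    (T : measurableType d) (P : probability T R) (g h : R)
    (beta : R -> T -> R) (x : R) : \bar R :=
  ((- (7 * c1 g h / (64 * h ^+ 3)))%R%:E
   * 'E_P[fun w => (path_derivative beta x w ^+ 3)%R])%E.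

(* Main.v *)
(* Reversing x and then translating swaps the endpoints of an increment, so
   every increment of beta has a symmetric law. The cubes of its difference
   quotients therefore have mean zero, once integrable, and dominated
   convergence gives E((d_x beta)^3) = 0. The domination comes from
   ergodicity: for each n, the event that a path is n-Lipschitz is invariant,
   hence of probability 0 or 1, and since almost every path is bounded in C^1
   some n has probability 1. *)

Require Import Defs.
From HB Require Import structures.
From mathcomp Require Import all_boot all_order all_algebra.
From mathcomp Require Import all_classical all_reals all_analysis.
From mathcomp Require Import measurable_realfun.
Import Order.TTheory GRing.Theory Num.Theory.
Import numFieldNormedType.Exports.
Local Open Scope classical_set_scope.
Local Open Scope ring_scope.

(** * Integrals of functions compared off a null set *)

Section integral_ae_eq_without_measurability.
Set Implicit Arguments.
Unset Strict Implicit.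
Context (d : measure_display) (T : measurableType d) (R : realType).
Variable mu : {measure set T -> \bar R}.
Local Open Scope ereal_scope.
Import HBNNSimple.

(* The derivative of beta at a point is only measurable off a null set, whereas
   the library's comparisons of integrals ask for measurable integrands. *)
Lemma nonmeasurable_ge0_ae_le_integral (f g : T -> \bar R) :
  (forall x, 0 <= f x) -> (forall x, 0 <= g x) ->
  {ae mu, forall x, f x <= g x} -> \int[mu]_x f x <= \int[mu]_x g x.
Proof.
move=> f0 g0 [N [mN muN fgN]].
rewrite [leLHS]ge0_integralTE// [leRHS]ge0_integralTE//.
apply: ge_ereal_sup => _ [u /= uf <-].
apply: ereal_sup_ubound.
(* Cutting [u] to zero on [N] puts it below [g] everywhere, and its integral is unchanged because
   [N] is null. *)
pose v := proj_nnsfun u (measurableC mN).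
have vE x : v x = (u \_ (~` N)) x by rewrite (mrestrict _ (measurableC mN)).
exists v.
  move=> x; rewrite vE patchE; case: ifPn => // xN.
  apply: le_trans (uf x) _.
  by apply: contrapT => fgx; move: xN; rewrite inE; apply; exact: fgN.
rewrite -2!integralT_nnsfun; apply: ae_eq_integral => //.
- exact/measurable_EFinP.
- exact/measurable_EFinP.
exists N; split => // x /= uN; apply: contrapT => xN; apply: uN => _.
have := vE x; rewrite patchE mem_set// => vux.
exact: (congr1 EFin vux).
Qed.

Lemma nonmeasurable_ae_eq_integral (f g : T -> \bar R) :
  {ae mu, forall x, f x = g x} -> \int[mu]_x f x = \int[mu]_x g x.
Proof.
have aux (f' g' : T -> \bar R) : (forall x, 0 <= f' x) ->
    (forall x, 0 <= g' x) -> {ae mu, forall x, f' x = g' x} ->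
    \int[mu]_x f' x = \int[mu]_x g' x.
  move=> f0 g0 fg; apply/eqP; rewrite eq_le; apply/andP.
  by split; apply: nonmeasurable_ge0_ae_le_integral => //;
    apply: filterS fg => x ->.
move=> fg; rewrite [LHS]integralE [RHS]integralE.
by congr (_ - _); apply: aux => //; apply: filterS fg => x fgx;
  rewrite ?funeposE ?funenegE fgx.
Qed.

End integral_ae_eq_without_measurability.

(** [U] and [- U] push [mu] forward to the same measure, so the positive and negative parts of [U]
    have equal integrals. Integrability makes these finite, so that they cancel. *)
Lemma integral_symmetric_eq0 (d : measure_display) (T : measurableType d)
    (R : realType) (mu : {measure set T -> \bar R}) (U : T -> R) :
  mu.-integrable setT (EFin \o U) ->
  (forall A : set R, measurable A -> mu (U @^-1` A) = mu ((\- U) @^-1` A)) ->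
  (\int[mu]_w (U w)%:E = 0)%E.
Proof.
move=> iU sU.
have mU : measurable_fun setT U by exact/measurable_EFinP/(measurable_int mu).
have mNU : measurable_fun setT (\- U) by exact: measurableT_comp.
pose p (r : R) := (Num.max r 0)%:E.
have mp : measurable_fun setT p.
  by apply/measurable_EFinP/measurable_maxr.
have p0 : {in setT, forall r, 0 <= p r}%E.
  by move=> r _; rewrite lee_fin le_max lexx orbT.
have E : (\int[mu]_w p (U w) = \int[mu]_w p (- U w)%R)%E.
  transitivity (\int[pushforward mu U]_r p r)%E.
    by rewrite (ge0_integral_pushforward mU).
  transitivity (\int[pushforward mu (\- U)%R]_r p r)%E.
    by apply: eq_measure_integral => A mA _; exact: sU.
  by rewrite (ge0_integral_pushforward mNU).
rewrite integralE.
rewrite [X in (X - _)%E](_ : _ = \int[mu]_w p (U w))%E; last first.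
  by apply: eq_integral => w _; rewrite funeposE /p/= EFin_max.
rewrite [X in (_ - X)%E](_ : _ = \int[mu]_w p (U w))%E; last first.
  by rewrite E; apply: eq_integral => w _; rewrite funenegE /p/= EFin_max.
rewrite subee//.
rewrite [X in X \is a _](_ : _ = \int[mu]_w (EFin \o U)^\+ w)%E; last first.
  by apply: eq_integral => w _; rewrite funeposE /p/= EFin_max.
by apply: integrable_fin_num => //; exact: integrable_funepos.
Qed.

(** * Lipschitz bounds and difference quotients of a path *)

Section lipschitz_paths.
Set Implicit Arguments.
Unset Strict Implicit.
Context (R : realType).
Implicit Types (f : R -> R) (M : R).

(* Restricted to rational points so that it defines a measurable set of paths. *)
Definition rat_lipschitz f M := forall pq : rat * rat,
  `|f (ratr pq.1) - f (ratr pq.2)| <= M * `|ratr pq.1 - ratr pq.2|.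

Lemma continuous_ge0_rat f :
  continuous f -> (forall q : rat, 0 <= f (ratr q)) -> forall x, 0 <= f x.
Proof.
move=> cf f0 x; rewrite leNgt; apply/negP => fx.
have oU : open (f @^-1` [set y | y < 0]).
  by apply: open_comp => //; exact: open_lt.
have [y [fq [q _ qE]]] := dense_rat (ex_intro _ x fx) oU.
by move: fq; rewrite -qE /= ltNge f0.
Qed.

Lemma rat_lipschitzE f M : continuous f -> rat_lipschitz f M ->
  forall x y, `|f x - f y| <= M * `|x - y|.
Proof.
move=> cf fM x y.
have cg z : continuous (fun t => M * `|t - z| - `|f t - f z|).
  move=> t; apply: cvgB.
    apply: cvgM; first exact: cvg_cst.
    by apply: cvg_norm; apply: cvgB; [exact: cvg_id|exact: cvg_cst].
  by apply: cvg_norm; apply: cvgB; [exact: cf|exact: cvg_cst].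
(* Density is used one variable at a time: [x] is replaced by a rational [p], then [y] by a rational
   [q]. *)
rewrite -subr_ge0; apply: (continuous_ge0_rat (cg y)) => p.
rewrite distrC [`|f _ - _|]distrC.
apply: (continuous_ge0_rat (cg (ratr p))) => q.
by rewrite subr_ge0; exact: (fM (q, p)).
Qed.

Lemma bounded_C1_continuous f : bounded_C1 f -> continuous f.
Proof.
by move=> [df _ _] x; apply: differentiable_continuous; exact/derivable1_diffP.
Qed.

(** This is the mean value theorem. The constant is rounded up to a natural number so that countably
    many Lipschitz events cover almost every path. *)
Lemma bounded_C1_rat_lipschitz f :
  bounded_C1 f -> exists n : nat, rat_lipschitz f n%:R.
Proof.
move=> bf; have cf := bounded_C1_continuous bf.
case: bf => df _ [M fM].
exists (Num.bound M) => -[p q] /=.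
move: (ratr p) (ratr q) => {p q}.
suff H x y : x <= y -> `|f x - f y| <= (Num.bound M)%:R * `|x - y|.
  move=> x y; have [/H//|/ltW/H] := leP x y.
  by rewrite distrC [`|y - x|]distrC.
move=> xy; have [||c _ fE] := @MVT_segment _ f (derive1 f) x y xy.
- by move=> z _; rewrite derive1E; exact/derivableP.
- exact: continuous_subspaceT.
rewrite distrC fE normrM [`|y - x|]distrC ler_wpM2r//.
apply: le_trans (fM c).2 _.
by apply/ltW/archi_boundP; apply: le_trans (fM c).1.
Qed.

(** Fixing the increments 1/(k+1) turns the derivative into the limit of a sequence, as dominated
    convergence requires. *)
Lemma cvg_difference_quotient f x : derivable f x 1 ->
  (fun k => (harmonic k)^-1 * (f (harmonic k + x) - f x)) @ \oo -->
  derive1 f x.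
Proof.
move=> df.
have : (fun e => e^-1 *: (f (e + x) - f x)) @ 0^' --> derive1 f x.
  move: df; rewrite /derivable /derive1.
  (* The two quotients differ only in writing the increment as [e *: 1] or as [e]. *)
  set u := fun _ : R => _; set v := fun _ : R => _.
  suff -> : u = v by [].
  by rewrite funeqE => e; rewrite /u /v /= [e%:A]mulr1.
move/cvgr_dnbhsP; apply; split; last exact: cvg_harmonic.
by move=> n; rewrite gt_eqF// harmonic_gt0.
Qed.

End lipschitz_paths.

(** * Consequences of reversibility and ergodicity *)

Section path_law.
Set Implicit Arguments.
Unset Strict Implicit.
Context (R : realType) (d : measure_display) (T : measurableType d).
Variables (P : probability T R) (tau : R -> T -> T) (beta : R -> T -> R).
Hypothesis tau_erg : ergodic_translations P tau.
Hypothesis beta_measurable : forall x, measurable_fun setT (beta x).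
Hypothesis beta_shift : forall x y w, beta x (tau y w) = beta (x + y) w.

(** Lets the equality of laws in [reversible] be applied to increments. Evaluations are measurable
    for the sigma-algebra they generate, hence so are their differences. *)
Lemma path_events_increment (x y : R) (A : set R) : measurable A ->
  path_events [set f : R -> R | A (f x - f y)].
Proof.
move=> mA.
pose G := \bigcup_(x in [set: R])
  preimage_set_system setT (fun f : R -> R => f x) measurable.
have mev z : measurable_fun setT (fun f : g_sigma_algebraType G => f z).
  move=> _ B mB; rewrite setTI; apply: sub_sigma_algebra.
  by exists z => //; exists B => //; rewrite setTI.
have mB : measurable_fun setT (fun f : g_sigma_algebraType G => f x - f y).
  by apply: measurable_funB; exact: mev.
by have := mB measurableT A mA; rewrite setTI.
Qed.

(* Reversal sends x, y to - x, - y, and the translation by x + y then sends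
   these to y, x. *)
Lemma increment_symmetric (x y : R) (A : set R) :
  reversible P beta -> measurable A ->
  P ((fun w => beta x w - beta y w) @^-1` A) =
  P ((\- (fun w => beta x w - beta y w)) @^-1` A).
Proof.
move=> rev mA.
have := rev _ (path_events_increment x y mA) => /= <-.
have mU : measurable ((\- (fun w => beta x w - beta y w)) @^-1` A).
  rewrite -[X in measurable X]setTI.
  by apply: measurableT_comp => //; exact: measurable_funB.
rewrite -(translation_preserving tau_erg (- (x + y)) mU).
congr (P _); apply/seteqP; split=> w /=; rewrite !beta_shift !opprB;
  by rewrite !opprD !addrA addrN add0r [_ - x - y]addrAC addrN add0r.
Qed.

Lemma ae_rat_lipschitz : {ae P, forall w, bounded_C1 (beta ^~ w)} ->
  exists n : nat, {ae P, forall w, rat_lipschitz (beta ^~ w) n%:R}.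
Proof.
move=> [N [mN PN0 subN]].
have C1N w : ~ N w -> bounded_C1 (beta ^~ w).
  by move=> Nw; apply: contrapT => nC1; apply: Nw; exact: subN.
pose A n := [set w | rat_lipschitz (beta ^~ w) n%:R].
have mA n : measurable (A n).
  rewrite (_ : A n = \bigcap_(pq : rat * rat)
      [set w | `|beta (ratr pq.1) w - beta (ratr pq.2) w| <=
               n%:R * `|ratr pq.1 - ratr pq.2|]); last first.
    by apply/seteqP; split=> [w Aw pq _|w Aw pq]; exact: Aw.
  rewrite -[X in measurable X]setCK setC_bigcap; apply: measurableC.
  apply: countable_bigcupT_measurable => // pq; apply: measurableC.
  have mU : measurable_fun setT
      (fun w => `|beta (ratr pq.1) w - beta (ratr pq.2) w|).
    by apply: measurableT_comp => //; exact: measurable_funB.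
  have := mU measurableT _
    (measurable_itv `]-oo, n%:R * `|ratr pq.1 - ratr pq.2|]).
  by rewrite setTI; congr measurable; apply/seteqP; split=> w /=; rewrite in_itv.
(* Off [N] paths are continuous, so the bound extends from rational to real pairs and survives a
   shift by an irrational [y]. The symmetric difference therefore lies in [N]. *)
have invA n y : P (tau y @^-1` A n `+` A n) = 0%E.
  apply: (subset_measure0 _ _ _ PN0) => //.
    have mtA : measurable (tau y @^-1` A n).
      rewrite -[X in measurable X]setTI.
      exact: (translation_measurable tau_erg).
    by apply: measurableU; exact: measurableD.
  move=> w Aw; apply: contrapT => Nw.
  have cw := bounded_C1_continuous (C1N w Nw).
  have shiftE p q : beta (ratr p) (tau y w) - beta (ratr q) (tau y w) =
      beta (ratr p + y) w - beta (ratr q + y) w :> R by rewrite !beta_shift.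
  have shift_sub (a b c : R) : a + c - (b + c) = a - b.
    by rewrite opprD addrACA subrr addr0.
  have AE : A n (tau y w) <-> A n w.
    split=> [Aty|Aw' pq]; last first.
      by rewrite /= shiftE (le_trans (rat_lipschitzE cw Aw' _ _))// shift_sub.
    have cy : continuous (fun t => beta (t + y) w).
      move=> t; apply: (@continuous_comp _ _ _ (fun t => t + y) (beta ^~ w)).
        by apply: cvgD; [exact: cvg_id|exact: cvg_cst].
      exact: cw.
    have L : rat_lipschitz (fun t => beta (t + y) w) n%:R.
      by move=> pq; rewrite -shiftE; exact: Aty.
    move=> pq; have := rat_lipschitzE cy L (ratr pq.1 - y) (ratr pq.2 - y).
    by rewrite !subrK shift_sub.
  by case: Aw => -[/= Aw nAw]; apply: nAw; apply/AE.
(* If no [A n] had probability 1, all would be null; but together with [N] they cover [T]. *)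
have [[n PAn]|PA] := pselect (exists n, P (A n) = 1%E).
  exists n, (~` A n); split => //; first exact: measurableC.
  by rewrite probability_setC// PAn subee.
have A0 n : P.-negligible (A n).
  apply/negligibleP => //.
  have [//|An1] := translation_ergodic tau_erg (mA n) (invA n).
  by exfalso; apply: PA; exists n.
have : P.-negligible [set: T].
  apply: (@negligibleS _ _ _ _ (\bigcup_n A n `|` N)); last first.
    apply: negligibleU; first exact: negligible_bigcup.
    by apply/negligibleP.
  move=> w _; have [Nw|Nw] := pselect (N w); [by right|left].
  by have [n] := bounded_C1_rat_lipschitz (C1N w Nw); exists n.
move=> /(negligibleP _ measurableT) PT0.
have /eqP := probability_setT P.
by rewrite (_ : P [set: T] = 0%E)// eq_sym onee_eq0.
Qed.

End path_law.

Theorem proposition5p8 (R : realType) (d : measure_display)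
    (T : measurableType d) (P : probability T R)
    (g h : R) (tau : R -> T -> T) (G : T -> R)
    (beta : R -> T -> R)
    (hg : 0 < g) (hh : 0 < h)
    (htau : ergodic_translations P tau)
    (hG : measurable_fun setT G)
    (hbeta : forall x w, beta x w = G (tau x w))
    (hmean : forall x, ('E_P[beta x] = 0)%E)
    (hC1 : {ae P, forall w, bounded_C1 (beta ^~ w)})
    (hrev : reversible P beta) :
  forall x, b_coef P g h beta x = 0%E.
Proof.
move=> x.
have mbeta y : measurable_fun setT (beta y).
  rewrite (_ : beta y = G \o tau y); last by apply/funext => w; exact: hbeta.
  by apply: measurableT_comp => //; exact: (translation_measurable htau).
have beta_shift y z w : beta y (tau z w) = beta (y + z) w.
  by rewrite !hbeta (translationD htau).
have [n lip] := ae_rat_lipschitz htau mbeta beta_shift hC1.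
pose Q k w := (harmonic k)^-1 * (beta (harmonic k + x) w - beta x w).
have mQ k : measurable_fun setT (fun w => Q k w ^+ 3).
  apply: measurable_funX; apply: measurable_funM => //.
  exact: measurable_funB.
have good : {ae P, forall w, (forall k, `|Q k w| <= n%:R) /\
    Q ^~ w @ \oo --> path_derivative beta x w}.
  apply: filterS2 hC1 lip => w C1w lipw; split; last first.
    by apply: cvg_difference_quotient; case: C1w.
  move=> k; have hk : 0 < harmonic k :> R := harmonic_gt0 k.
  rewrite /Q normrM normfV (gtr0_norm hk) mulrC ler_pdivrMr//.
  have cw := bounded_C1_continuous C1w.
  apply: le_trans (rat_lipschitzE cw lipw _ _) _.
  by rewrite addrK gtr0_norm.
have Q3_le k w : `|Q k w| <= n%:R -> `|Q k w ^+ 3| <= n%:R ^+ 3.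
  by move=> Qn; rewrite normrX lerXn2r ?nnegrE.
(* One null set serves every [k]: off [N] the bounds and the convergence hold at each point. *)
have [N [mN PN0 goodN]] := good.
have {}goodN w : (~` N) w -> (forall k, `|Q k w| <= n%:R) /\
    Q ^~ w @ \oo --> path_derivative beta x w.
  by move=> Nw; apply: contrapT => bad; apply: Nw; exact: goodN.
pose D3 w := (path_derivative beta x w ^+ 3)%:E.
have Q3_cvg w : (~` N) w -> (Q k w ^+ 3)%:E @[k --> \oo] --> D3 w.
  move=> /goodN[_ Qw]; apply: cvg_EFin; first exact: nearW.
  apply: (@continuous_cvg _ _ _ _ _ _ (fun r : R => r ^+ 3)) => //.
  exact: exprn_continuous.
have mNC : measurable (~` N) by exact: measurableC.
have bnd : P.-integrable (~` N) (EFin \o cst (n%:R ^+ 3)).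
  exact: finite_measure_integrable_cst.
have iQ k : P.-integrable setT (fun w => (Q k w ^+ 3)%:E).
  apply/(negligible_integrable mN) => //; first exact/measurable_EFinP.
  rewrite setTD; apply: le_integrable bnd => //.
    by apply/measurable_EFinP; apply: measurable_funS (mQ k).
  move=> w /goodN[Qn _]; rewrite /= lee_fin.
  by apply: le_trans (Q3_le _ _ (Qn k)) _; exact: ler_norm.
have Q0 k : (\int[P]_w (Q k w ^+ 3)%:E = 0)%E.
  apply: integral_symmetric_eq0 => [|A mA]; first exact: iQ.
  (* [cube] is odd and sends the increment to [Q k w ^+ 3], so the symmetry of the increment passes
     to the cubed quotient. *)
  pose cube r : R := ((harmonic k)^-1 * r) ^+ 3.
  have mcube : measurable_fun setT cube.
    by apply: measurable_funX; exact: measurable_funM.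
  have mcA : measurable (cube @^-1` A).
    by rewrite -[X in measurable X]setTI; exact: mcube.
  have := increment_symmetric htau mbeta beta_shift (harmonic k + x) x hrev mcA.
  move=> sym; rewrite [LHS]sym; congr (P _).
  by apply/seteqP; split=> w /=;
    rewrite /cube /Q mulrN exprNn -signr_odd expr1 mulN1r.
(* Pointwise convergence is known only off [N], hence the restriction of the domain. *)
have mD3 : measurable_fun (~` N) D3.
  apply: emeasurable_fun_cvg Q3_cvg => k; apply/measurable_EFinP.
  exact: measurable_funS (mQ k).
have [] := @dominated_convergence _ _ _ P _ mNC
  (fun k w => (Q k w ^+ 3)%:E) D3 (EFin \o cst (n%:R ^+ 3)) _ mD3 _ bnd _.
- by move=> k; apply/measurable_EFinP; apply: measurable_funS (mQ k).
- by apply: aeW => w; exact: Q3_cvg.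
- by apply: aeW => w k /goodN[Qn _]; rewrite lee_fin; exact: Q3_le.
move=> _ _.
(* Removing the null set [N] does not change the integrals, which vanish by [Q0]; the limit is that
   of a constant sequence. *)
rewrite (_ : (fun _ => _) = cst 0%E); last first.
  by apply/funext => k; rewrite -setTD -negligible_integral.
move=> /(cvg_unique (@ereal_hausdorff R)) /(_ (cvg_cst _)) D30.
rewrite /b_coef unlock.
suff -> : (\int[P]_w (path_derivative beta x w ^+ 3)%:E = 0)%E by rewrite mule0.
transitivity (\int[P]_(w in ~` N) D3 w)%E; last by rewrite D30.
(* Extended by zero to [N], the restriction of [D3] agrees with [D3] almost everywhere, whatever the
   derivative does on [N]. *)
rewrite [RHS]integral_mkcond; apply: nonmeasurable_ae_eq_integral.
exists N; split => // w /= DN; apply: contrapT => Nw; apply: DN.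
by rewrite patchE mem_set.
Qed.
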